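(* Let $n\ge 1$ and let $K$ and $L$ be two symmetric $n\times n$ matrices over $\mathbb{Q}(\mu)$. Then the following two assertions are equivalent: (i) $\det(tI-K)=\det(tI-L)$ as polynomials in the indeterminate $t$ over $\mathbb{Q}(\mu)$; (ii) $K$ and $L$ are similar over $\mathbb{Q}(\mu)$, i.e., there exists an invertible $n\times n$ matrix $P$ with entries in $\mathbb{Q}(\mu)$ such that $P^{-1}KP=L$.
   Context: $\mathbb{Q}(\mu)$ denotes the field of rational functions in one indeterminate $\mu$ over $\mathbb{Q}$. A matrix $K$ is symmetric if it equals its transpose. $I$ is the identity matrix. *)

(* Defs.v *)
From mathcomp Require Import all_boot all_order all_algebra.

(* The indeterminate mu is the variable 'X of {poly rat}. It is not the 'X of
   {poly Qmu}, which is the indeterminate t of characteristic polynomials. *)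
Notation Qmu := {fraction {poly rat}}.

(* Main.v *)
(* Q(mu) is formally real, so A^T A = 0 forces A = 0. For K symmetric, if
   u^2 s is the minimal polynomial, then N = (u s)(K) is symmetric with N^2 = 0,
   so N = 0 and u is constant: the minimal polynomial is square-free, hence
   separable in characteristic 0, and K is diagonalizable over an algebraic
   closure E. Equal characteristic polynomials thus give similarity over E. It
   descends: the matrices Q with Q K = L Q form a space with a basis X_i over
   Q(mu), and the coordinates of an invertible solution over E can be moved one
   at a time into the infinite field Q(mu) while keeping det nonzero. *)
Require Import Defs.
From mathcomp Require Import all_boot all_order all_algebra.
From HB Require Import structures.
From mathcomp Require Import perm separable closed_field.
Local Open Scope ring_scope.

Import Order.TTheory GRing.Theory Num.Theory.

(** For a field this is equivalent to -1 not being a sum of squares; the form with families applies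
    directly to matrix columns. *)
Definition formally_real (F : fieldType) : Prop :=
  forall (m : nat) (x : 'I_m -> F),
    \sum_i x i ^+ 2 = 0 -> forall i, x i = 0.

Lemma formally_real_natr_neq0 (F : fieldType) (k : nat) :
  formally_real F -> k.+1%:R != 0 :> F.
Proof.
move=> realF; apply/eqP => k0.
suff /eqP: (1 : F) = 0 by rewrite oner_eq0.
apply: (realF k.+1 (fun=> 1) _ ord0).
by under eq_bigr do rewrite expr1n; rewrite sumr_const card_ord.
Qed.

Lemma formally_real_natr_inj (F : fieldType) :
  formally_real F -> injective (fun k : nat => k%:R : F).
Proof.
move=> realF i j; wlog lt_ij : i j / (i < j)%N => [IH|] eq_ij.
  by case: (ltngtP i j) => [/IH->|/IH->|].
have /eqP := formally_real_natr_neq0 F (j - i).-1 realF.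
by rewrite prednK ?subn_gt0 // natrB ?(ltnW lt_ij)// eq_ij subrr.
Qed.

(** The diagonal entry of [A^T *m A] at [j] is the sum of the squares of column [j]. *)
Lemma formally_real_trmx_mul_eq0 (F : fieldType) (m n : nat) (A : 'M[F]_(m, n)) :
  formally_real F -> A^T *m A = 0 -> A = 0.
Proof.
move=> realF AtA0; apply/matrixP => i j; rewrite mxE.
apply: (realF _ (fun i => A i j)).
have /matrixP/(_ j j) := AtA0; rewrite !mxE; apply: etrans.
by apply: eq_bigr => k _; rewrite mxE expr2.
Qed.

Lemma trmx_horner_mx (R : comNzRingType) (n : nat) (A : 'M[R]_n.+1) p :
  (horner_mx A p)^T = horner_mx A^T p.
Proof.
elim/poly_ind: p => [|p c IHp]; first by rewrite !rmorph0 trmx0.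
rewrite !rmorphD !rmorphM /= !horner_mx_X !horner_mx_C linearD /= tr_scalar_mx.
rewrite -!mulmxE trmx_mul IHp; congr (_ + _).
exact: comm_mx_horner.
Qed.

Lemma sym_mxminpoly_square_free (F : fieldType) (n : nat) (A : 'M[F]_n.+1) :
  formally_real F -> A^T = A ->
  forall u : {poly F}, size u != 1%N -> ~~ (u ^+ 2 %| mxminpoly A).
Proof.
move=> realF symA u; apply: contraNN => /dvdpP[s def_m].
(* With [N] the value of [u * s] at [A], symmetry gives N^T N = N^2, and (u s)^2 is [s] times the
   minimal polynomial. *)
have us0 : horner_mx A (u * s) = 0.
  apply: formally_real_trmx_mul_eq0 => //; rewrite trmx_horner_mx symA mulmxE.
  rewrite -rmorphM mulrACA -expr2 mulrC -mulrA -def_m rmorphM /=.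
  by rewrite mx_root_minpoly mulr0.
have m_neq0 := monic_neq0 (mxminpoly_monic A).
(* By minimality s u^2 divides u s; cancelling u s leaves u dividing 1. *)
have := mxminpoly_min us0; rewrite def_m => dvd_us.
have us_neq0 : u * s != 0.
  by move: m_neq0; rewrite def_m !mulf_eq0 => /norP[/negPf-> /norP[/negPf->]].
move: dvd_us; rewrite expr2 mulrA [s * u]mulrC -{2}[u * s]mulr1.
by rewrite dvdp_mul2l // dvdp1.
Qed.

Lemma sym_mxminpoly_separable (F : fieldType) (n : nat) (A : 'M[F]_n.+1) :
  formally_real F -> A^T = A -> separable_poly (mxminpoly A).
Proof.
move=> realF symA; apply/separable_polyP; split=> [|u _ u_gt1].
  exact/poly_square_freeP/sym_mxminpoly_square_free.
(* A factor [u] of degree k+1 has nonzero derivative: its coefficient at [k] is k+1 times the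
   leading coefficient of [u]. *)
case def_k: (size u) u_gt1 => [|[|k]] // _; apply/eqP => /polyP/(_ k)/eqP.
rewrite coef0 coef_deriv -mulr_natr mulf_eq0 (negPf (formally_real_natr_neq0 _ _ realF)) orbF.
by rewrite -[k.+1]/(k.+2.-1) -def_k -lead_coefE lead_coef_eq0 -size_poly_eq0 def_k.
Qed.

Lemma sym_mx_diagonalizable (F : fieldType) (E : closedFieldType)
    (f : {rmorphism F -> E}) (n : nat) (A : 'M[F]_n.+1) :
  formally_real F -> A^T = A ->
  exists2 P, P \in unitmx & exists d, P *m map_mx f A = diag_mx d *m P.
Proof.
move=> realF symA.
have sepA := sym_mxminpoly_separable _ _ _ realF symA.
have [rs def_m] := closed_field_poly_normal (mxminpoly (map_mx f A)).
have m_monic := mxminpoly_monic (map_mx f A).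
rewrite (monicP m_monic) scale1r in def_m.
have [|P Pu /diagonalizable_forPex[d /(simmxP Pu) PA]] :=
  (diagonalizableP (map_mx f A)).2; last by exists P => //; exists d.
exists rs; last by rewrite def_m.
(* Separability survives the extension to [E], so the roots [rs] are distinct. *)
by rewrite -separable_prod_XsubC -def_m mxminpoly_map separable_map.
Qed.

(** Unique factorization into linear factors makes the two diagonals permutations of each other, and
    the permutation matrix intertwines them. *)
Lemma diag_mx_char_poly_sim (F : fieldType) (n : nat) (d e : 'rV[F]_n) :
  char_poly (diag_mx d) = char_poly (diag_mx e) ->
  exists2 Q, Q \in unitmx & Q *m diag_mx d = diag_mx e *m Q.
Proof.
rewrite !char_poly_trig ?diag_mx_is_trig //.
have XsubC_tuple (c : 'rV[F]_n) :
    \prod_(i < n) ('X - (diag_mx c i i)%:P)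
    = \prod_(x <- [tuple c 0 i | i < n]) ('X - x%:P).
  rewrite big_map big_enum /=; apply: eq_bigr => i _.
  by rewrite mxE eqxx.
rewrite !XsubC_tuple => /esym/prod_XsubC_eq/tuple_permP[s /val_inj/= def_e].
exists (perm_mx s); first exact: unitmx_perm.
have e_s i : e 0 i = d 0 (s i).
  by have := congr1 (fun t => tnth t i) def_e; rewrite !tnth_mktuple.
rewrite -row_permE; apply/matrixP => i j.
rewrite mul_diag_mx !mxE e_s.
by case: eqP => [->|]; rewrite ?mulr1 ?mulr0.
Qed.

Lemma det_line_specialize (F : fieldType) (E : idomainType)
    (f : {rmorphism F -> E}) (n : nat) (M N : 'M[E]_n) (t0 : E) :
  injective (fun k : nat => k%:R : F) ->
  \det (M + t0 *: N) != 0 -> exists t : F, \det (M + f t *: N) != 0.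
Proof.
move=> natr_inj det_t0.
pose p := \det (map_mx polyC M + 'X *: map_mx polyC N).
have horner_p t : p.[t] = \det (M + t *: N).
  rewrite -[LHS]/(horner_eval t p) -det_map_mx; congr (\det _).
  apply/matrixP => i j; rewrite !mxE /= /horner_eval.
  by rewrite hornerD hornerM hornerX !hornerC.
have p_neq0 : p != 0 by apply: contraNneq det_t0; rewrite -horner_p => ->; rewrite horner0.
(* A nonzero [p] has fewer than [size p] roots, so one of these distinct values is not a root. *)
pose rs := [seq f k%:R | k <- iota 0 (size p)].
have rs_uniq : uniq rs.
  by rewrite map_inj_uniq ?iota_uniq // => i j /fmorph_inj/natr_inj.
have /allPn[_ /mapP[k _ ->]] : ~~ all (root p) rs.
  apply/negP => rs_roots; have := max_poly_roots p_neq0 rs_roots rs_uniq.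
  by rewrite size_map size_iota ltnn.
by rewrite rootE horner_p => det_k; exists k%:R.
Qed.

Lemma det_span_specialize (F : fieldType) (E : idomainType)
    (f : {rmorphism F -> E}) (n m : nat) (X : 'I_m -> 'M[F]_n) (c : 'I_m -> E)
    (M : 'M[F]_n) :
  injective (fun k : nat => k%:R : F) ->
  \det (map_mx f M + \sum_i c i *: map_mx f (X i)) != 0 ->
  exists a : 'I_m -> F, \det (M + \sum_i a i *: X i) != 0.
Proof.
move=> natr_inj; elim: m => [|m IHm] in X c M *.
  rewrite big_ord0 addr0 det_map_mx fmorph_eq0 => detM.
  by exists (fun=> 0); rewrite big_ord0 addr0.
(* The first coefficient moves to [t] in [F]; its term is then absorbed into [M], which is why the
   statement carries a constant term over [F]. *)
rewrite big_ord_recl addrCA addrC => /det_line_specialize-/(_ _ f natr_inj)[t].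
rewrite -map_mxZ addrAC -map_mxD => /IHm[a det_a].
exists (fun i => oapp a t (unlift ord0 i)); rewrite big_ord_recl unlift_none /=.
by under eq_bigr do rewrite liftK; rewrite addrA.
Qed.

Lemma sim_descent (F E : fieldType) (f : {rmorphism F -> E}) (n : nat)
    (A B : 'M[F]_n) (P : 'M[E]_n) :
  injective (fun k : nat => k%:R : F) -> P \in unitmx ->
  P *m map_mx f A = map_mx f B *m P ->
  exists2 Q, Q \in unitmx & Q *m A = B *m Q.
Proof.
move=> natr_inj Pu PA.
pose S := kermx (lin_mx (mulmxr A) - lin_mx (mulmx B)).
pose X i := vec_mx (row i S).
have XA i : X i *m A = B *m X i.
  have /sub_kermxP/eqP : (row i S <= S)%MS := row_sub i S.
  by rewrite mulmxBr !mul_rV_lin /= subr_eq0 => /eqP/(can_inj mxvecK).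
(* The equation is linear with coefficients in [F], and kernels commute with field extension: the
   rows of [S] also span the solutions over [E]. *)
have [|c def_P] := submxP (_ : (mxvec P <= map_mx f S)%MS).
  rewrite /S map_kermx map_mxB.
  rewrite (map_lin_mx (gf := mulmxr (map_mx f A))) => [|C]; last exact: map_mxM.
  rewrite (map_lin_mx (gf := mulmx (map_mx f B))) => [|C]; last exact: map_mxM.
  by apply/sub_kermxP; rewrite mulmxBr !mul_vec_lin /= PA subrr.
have [|a] := det_span_specialize _ _ f n _ X (c 0) 0 natr_inj.
  rewrite map_mx0 add0r; move: Pu; rewrite unitmxE unitfE; congr (\det _ != 0).
  rewrite -[LHS]mxvecK def_P mulmx_sum_row linear_sum; apply: eq_bigr => i _.
  by rewrite linearZ /= -map_row map_vec_mx.
rewrite add0r => det_Q; exists (\sum_i a i *: X i); first by rewrite unitmxE unitfE.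
rewrite mulmx_suml mulmx_sumr; apply: eq_bigr => i _.
by rewrite -scalemxAl -scalemxAr XA.
Qed.

(** [Q] also intertwines the characteristic matrices over polynomials; its determinant, a nonzero
    constant, cancels. *)
Lemma similar_char_poly (F : fieldType) (n : nat) (A B Q : 'M[F]_n) :
  Q \in unitmx -> Q *m A = B *m Q -> char_poly A = char_poly B.
Proof.
rewrite unitmxE unitfE => Qu QA.
have Qu' : \det (map_mx polyC Q) != 0 by rewrite det_map_mx polyC_eq0.
apply: (mulfI Qu'); rewrite [RHS]mulrC -!det_mulmx /char_poly_mx.
rewrite mulmxBr mulmxBl -scalar_mxC; congr (\det (_ - _)).
by rewrite -!map_mxM QA.
Qed.

Lemma sym_char_poly_sim (F : fieldType) (E : closedFieldType)
    (f : {rmorphism F -> E}) (n : nat) (A B : 'M[F]_n.+1) :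
  formally_real F -> A^T = A -> B^T = B -> char_poly A = char_poly B ->
  exists2 Q, Q \in unitmx & Q *m A = B *m Q.
Proof.
move=> realF symA symB eq_char.
have char_diag (C : 'M[F]_n.+1) (P : 'M[E]_n.+1) d : P \in unitmx ->
    P *m map_mx f C = diag_mx d *m P ->
    char_poly (diag_mx d) = map_poly f (char_poly C).
  move=> Pu PC; rewrite map_char_poly; exact/esym/(similar_char_poly _ _ _ _ _ Pu PC).
have [P Pu [d PA]] := sym_mx_diagonalizable _ _ f _ _ realF symA.
have [R Ru [e RB]] := sym_mx_diagonalizable _ _ f _ _ realF symB.
have [|Q Qu Qd] := diag_mx_char_poly_sim E _ d e.
  by rewrite (char_diag _ _ _ Pu PA) (char_diag _ _ _ Ru RB) eq_char.
(* [P] diagonalizes [A], [Q] reorders the eigenvalues, and the inverse of [R] leads back to [B]. *)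
apply: (sim_descent _ _ f _ _ _ (invmx R *m Q *m P)).
- exact: formally_real_natr_inj.
- by rewrite !unitmx_mul unitmx_inv Ru Qu.
rewrite -!mulmxA PA mulmxA [in LHS]mulmxA -[_ *m Q *m _]mulmxA Qd.
apply: (can_inj (mulKmx Ru)).
by rewrite !mulmxA mulmxV // mul1mx RB mulmxK.
Qed.

Lemma fraction_repr (R : idomainType) (x : {fraction R}) :
  let r := frac (repr x) in x = FracField.tofrac r.1 / FracField.tofrac r.2.
Proof.
set r := repr x.
have d_neq0 : FracField.tofrac (frac r).2 != 0 by rewrite tofrac_eq0 denom_ratioP.
apply: (mulIf d_neq0); rewrite divfK // -[x in LHS](reprK x) -/r.
unlock FracField.tofrac.
rewrite -[LHS]FracField.pi_mul; apply/eqmodP.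
rewrite /= /equivf /FracField.mulf !numden_Ratio ?mulf_neq0 ?oner_eq0 ?denom_ratioP //.
by rewrite !mulr1 mulrC.
Qed.

(** At each rational point the values are squares in an ordered field with sum zero, so every [p i]
    vanishes at more points than its degree. *)
Lemma rat_poly_sum_sqr_eq0 (m : nat) (p : 'I_m -> {poly rat}) :
  \sum_i p i ^+ 2 = 0 -> forall i, p i = 0.
Proof.
move=> sum0 i; apply/eqP; apply: contraTT isT => pi_neq0.
pose rs := [seq k%:R : rat | k <- iota 0 (size (p i))].
have rs_uniq : uniq rs.
  by rewrite map_inj_uniq ?iota_uniq // => j k /eqP; rewrite eqr_nat => /eqP.
suff rs_roots : all (root (p i)) rs.
  by have := max_poly_roots pi_neq0 rs_roots rs_uniq; rewrite size_map size_iota ltnn.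
apply/allP => x _; rewrite rootE -sqrf_eq0.
have := congr1 (horner_eval x) sum0; rewrite rmorph_sum rmorph0 => /eqP.
rewrite psumr_eq0 => [|j _]; last by rewrite rmorphXn sqr_ge0.
by move/allP/(_ i (mem_index_enum _)); rewrite rmorphXn.
Qed.

Lemma Qmu_formally_real : formally_real Qmu.
Proof.
move=> m x sum0.
(* Clearing denominators: [q i] is [x i] times the product of all denominators. *)
pose d i := (frac (repr (x i))).2; pose D i := \prod_(j | j != i) d j.
pose q i := (frac (repr (x i))).1 * D i.
have d_neq0 i : d i != 0 by exact: denom_ratioP.
have xq i : x i * FracField.tofrac (\prod_j d j) = FracField.tofrac (q i).
  rewrite [x i]fraction_repr (bigD1 i) //= !rmorphM /= mulrA divfK //.
  by rewrite tofrac_eq0 d_neq0.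
have prod_neq0 : FracField.tofrac (\prod_j d j) != 0.
  by rewrite tofrac_eq0; apply/prodf_neq0.
have q0 i : q i = 0.
  apply: rat_poly_sum_sqr_eq0 i; apply/eqP; rewrite -tofrac_eq0 rmorph_sum /=.
  under eq_bigr do rewrite rmorphXn /= -xq exprMn.
  by rewrite -mulr_suml sum0 mul0r.
by move=> i; apply: (mulIf prod_neq0); rewrite xq q0 rmorph0 mul0r.
Qed.

(** The closure used is that of a countable field; choosing a numerator and a denominator injects
    [Qmu] into pairs of rational polynomials. *)
Lemma Qmu_closed_extension :
  {E : closedFieldType & {rmorphism Qmu -> E}}.
Proof.
pose to_pair (x : Qmu) := frac (repr x).
pose of_pair (r : {poly rat} * {poly rat}) : Qmu :=
  FracField.tofrac r.1 / FracField.tofrac r.2.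
have to_pairK : cancel to_pair of_pair by move=> x; rewrite [RHS]fraction_repr.
pose F : countFieldType := HB.pack Qmu (CanIsCountable to_pairK).
have [E [f _]] := countable_algebraic_closure F.
by exists E.
Qed.

Theorem theorem1 (n : nat) (hn : (1 <= n)%N) (K L : 'M[Qmu]_n)
    (hK : K^T = K) (hL : L^T = L) :
  char_poly K = char_poly L <->
  exists P : 'M[Qmu]_n, P \in unitmx /\ invmx P *m K *m P = L.
Proof.
have [E f] := Qmu_closed_extension.
case: n hn K L hK hL => [//|n _ K L hK hL]; split=> [eq_char | [P [Pu <-]]].
  (* The roles are swapped, since P^-1 K P = L means that P L = K P. *)
  have [P Pu PL] :=
    sym_char_poly_sim _ _ f _ _ _ Qmu_formally_real hL hK (esym eq_char).
  exists P; split; first exact: Pu.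
  by rewrite -mulmxA -PL (mulKmx Pu).
have Vu : invmx P \in unitmx by rewrite unitmx_inv.
apply: (similar_char_poly _ _ _ _ _ Vu).
by rewrite (mulmxK Pu).
Qed.
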